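(* Assume the $k$-sum hardness hypothesis: for each $k$, the problem $k$-sum on sets of size at most $N$ cannot be solved in time $o(N^{\lceil k/2\rceil})$. Then for any positive integer $m$ there exists an FAQ-AI query $Q$ with no free variables ($F=\emptyset$) such that $\mathrm{faqw}_\ell(Q)\ge m$ and $Q$ cannot be answered in time $o\!\left(N^{\mathrm{faqw}_\ell(Q)}\right)$.
   Context: **$k$-sum.** Given $k$ sets of numbers $R_1,\dots,R_k$ of maximum size $N$, determine whether there is $(t_1,\dots,t_k)\in R_1\times\cdots\times R_k$ with $\sum_{i\in[k]}t_i=0$. **FAQ-AI queries.** Let $(\mathbf D,\oplus,\otimes,\mathbf 0,\mathbf 1)$ be a commutative semiring (e.g. the Boolean semiring) whose operations take $O(1)$ time. Let $\mathcal V=[n]$; each $i\in\mathcal V$ has a variable $X_i$ with discrete domain $\mathrm{Dom}(X_i)$; for $K\subseteq\mathcal V$ write $\mathbf x_K=(x_i)_{i\in K}$. For an event $A$, $\mathbf 1_A=\mathbf 1$ if $A$ holds and $\mathbf 0$ otherwise. An FAQ-AI query is given by a multi-hypergraph $\mathcal H=(\mathcal V,\mathcal E)$, a partition of the edge multiset $\mathcal E=\mathcal E_s\cup\mathcal E_\ell$ (skeleton and ligament edges), a set $F\subseteq\mathcal V$ of free variables, a factor $R_K:\prod_{i\in K}\mathrm{Dom}(X_i)\to\mathbf D$ for each $K\in\mathcal E_s$, and functions $\theta^S_v:\mathrm{Dom}(X_v)\to\mathbb R$ ($v\in S$) for each $S\in\mathcal E_\ell$, each evaluable in $O(1)$ time.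 Its output is $$Q(\mathbf x_F)=\bigoplus_{\mathbf x_{\mathcal V\setminus F}}\Big(\bigotimes_{K\in\mathcal E_s}R_K(\mathbf x_K)\Big)\otimes\Big(\bigotimes_{S\in\mathcal E_\ell}\mathbf 1_{\sum_{v\in S}\theta^S_v(x_v)\le 0}\Big).$$ $|R_K|$ is the number of tuples in the support of $R_K$; $\mathcal E_{\not\infty}\subseteq\mathcal E_s$ is the set of skeleton edges with $|R_K|<\infty$ (these factors are given as lists of support tuples with values); it is assumed that $\bigcup_{K\in\mathcal E_{\not\infty}}K=\mathcal V$; $N=\max_{K\in\mathcal E_{\not\infty}}|R_K|$. Running times are in data complexity: the query (hypergraph, semiring, free variables) is fixed, and the factors $R_K$ and functions $\theta^S_v$ are the input. **Relaxed FAQ-width.** A relaxed tree decomposition of $\mathcal H$ is a pair $(T,\chi)$ with $T=(V(T),E(T))$ a tree and $\chi:V(T)\to2^{\mathcal V}$ such that: (a) for each $v\in\mathcal V$, $\{t: v\in\chi(t)\}$ is a connected subtree of $T$; (b) each $S\in\mathcal E_s$ is contained in some bag $\chi(t)$; (c) each $S\in\mathcal E_\ell$ satisfies $S\subseteq\chi(s)\cup\chi(t)$ for some $\{s,t\}\in E(T)$. Let $\mathrm{TD}^\ell_\emptyset$ be the set of all relaxed tree decompositions. $\Gamma_n$ is the set of polymatroids on $[n]$ (monotone submodular $h:2^{\mathcal V}\to\mathbb R_+$ with $h(\emptyset)=0$) and $\mathrm{ED}_{\not\infty}=\{h:2^{\mathcal V}\to\mathbb R_+ : h(S)\le1\ \forall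 S\in\mathcal E_{\not\infty}\}$. For $F=\emptyset$, $$\mathrm{faqw}_\ell(Q)=\min_{(T,\chi)\in\mathrm{TD}^\ell_\emptyset}\ \max_{h\in\mathrm{ED}_{\not\infty}\cap\Gamma_n}\ \max_{t\in V(T)}h(\chi(t)).$$ *)

(* Defs.v *)
From HB Require Import structures.
From mathcomp Require Import all_boot all_order all_algebra.
From mathcomp Require Import all_classical all_reals all_analysis.

Set Implicit Arguments.
Unset Strict Implicit.
Unset Printing Implicit Defensive.

Import Order.TTheory GRing.Theory Num.Theory.
Import numFieldNormedType.Exports.

Local Open Scope classical_set_scope.
Local Open Scope ring_scope.

(** * A uniform unit-cost real RAM

  Programs are finite structured programs over three unbounded memories, holding
  indices (natural numbers), real numbers, and values of one further data type
  [carrier] (the semiring elements, for FAQ-AI queries).  Each memory consists of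
  arrays named by natural numbers; the cell [(a, xs)] is the entry of the array
  [a] whose coordinates are the current values of the scalar index variables
  [xs], the scalar index variable [x] being the cell [(x, [::])].

  The index operations are addition and truncated subtraction only: on unbounded
  indices, unit-cost multiplication and division would be unrealistically
  powerful; multi-dimensional arrays are available without them.  Real numbers
  can be compared and combined with the field operations, but neither truncated
  nor converted to indices.

  The input is read through unit-cost access functions whose arguments are
  indices. *)

Record signature := Signature {
  carrier : choiceType;
  carrier0 : carrier;
  cop : Type;
  cop_fun : cop -> carrier -> carrier -> carrier;
  nsym : Type;
  rsym : Type;
  csym : Type }.

Record access (R : Type) (G : signature) := Access {
  nget : nsym G -> seq nat -> nat;
  rget : rsym G -> seq nat -> R;
  cget : csym G -> seq nat -> carrier G }.

Definition cell : Type := (nat * seq nat)%type.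

Variant nop := NAdd | NSub.
Variant rop := RAdd | RSub | RMul | RDiv.

Variant test :=
  | NLe of cell & cell
  | RLe of cell & cell
  | CEq of cell & cell.

(* In the assignments, the first cell is the destination. *)
Inductive program (G : signature) :=
  | Skip
  | NConst of cell & nat
  | NOp of nop & cell & cell & cell
  | NGet of cell & nsym G & seq cell
  | RCast of cell & cell
  | ROp of rop & cell & cell & cell
  | RGet of cell & rsym G & seq cell
  | COp of cop G & cell & cell & cell
  | CGet of cell & csym G & seq cell
  | Seq of program G & program G
  | If of test & program G & program G
  | While of test & program G.

Arguments Skip {G}.
Arguments NConst {G} _ _.
Arguments NOp {G} _ _ _ _.
Arguments RCast {G} _ _.
Arguments ROp {G} _ _ _ _.

Record state (R : Type) (G : signature) := State {
  nmem : cell -> nat;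
  rmem : cell -> R;
  cmem : cell -> carrier G }.

Section Semantics.
Variables (R : realType) (G : signature).
Implicit Types (s : state R G) (c d e : cell).

Definition init_state : state R G :=
  State (fun=> 0%N) (fun=> 0) (fun=> carrier0 G).

Definition upd (V : Type) (f : cell -> V) (c : cell) (x : V) : cell -> V :=
  fun d => if d == c then x else f d.

Definition addr s c : cell := (c.1, [seq nmem s (x, [::]) | x <- c.2]).

Definition nval s c : nat := nmem s (addr s c).
Definition rval s c : R := rmem s (addr s c).
Definition cval s c : carrier G := cmem s (addr s c).

Definition nset s c x := State (upd (nmem s) (addr s c) x) (rmem s) (cmem s).
Definition rset s c x := State (nmem s) (upd (rmem s) (addr s c) x) (cmem s).
Definition cset s c x := State (nmem s) (rmem s) (upd (cmem s) (addr s c) x).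

Definition nop_fun (o : nop) (m n : nat) : nat :=
  match o with NAdd => (m + n)%N | NSub => (m - n)%N end.

Definition rop_fun (o : rop) (x y : R) : R :=
  match o with
  | RAdd => x + y | RSub => x - y | RMul => x * y | RDiv => x / y
  end.

Definition test_fun s (b : test) : bool :=
  match b with
  | NLe d e => (nval s d <= nval s e)%N
  | RLe d e => rval s d <= rval s e
  | CEq d e => cval s d == cval s e
  end.

(* [exec i p s t s'] : on the input [i], the program [p] started in the state
   [s] halts in the state [s'] after exactly [t] steps. *)
Inductive exec (i : access R G) :
    program G -> state R G -> nat -> state R G -> Prop :=
  | ExecSkip s : exec i Skip s 1 s
  | ExecNConst s c n : exec i (NConst c n) s 1 (nset s c n)
  | ExecNOp s o c d e :
      exec i (NOp o c d e) s 1 (nset s c (nop_fun o (nval s d) (nval s e)))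
  | ExecNGet s c f ds :
      exec i (NGet c f ds) s 1 (nset s c (nget i f (map (nval s) ds)))
  | ExecRCast s c d : exec i (RCast c d) s 1 (rset s c (nval s d)%:R)
  | ExecROp s o c d e :
      exec i (ROp o c d e) s 1 (rset s c (rop_fun o (rval s d) (rval s e)))
  | ExecRGet s c f ds :
      exec i (RGet c f ds) s 1 (rset s c (rget i f (map (nval s) ds)))
  | ExecCOp s o c d e :
      exec i (COp o c d e) s 1 (cset s c (cop_fun o (cval s d) (cval s e)))
  | ExecCGet s c f ds :
      exec i (CGet c f ds) s 1 (cset s c (cget i f (map (nval s) ds)))
  | ExecSeq s1 s2 s3 t1 t2 p q :
      exec i p s1 t1 s2 -> exec i q s2 t2 s3 ->
      exec i (Seq p q) s1 (t1 + t2) s3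
  | ExecIfTrue s s' t b p q :
      test_fun s b -> exec i p s t s' -> exec i (If b p q) s t.+1 s'
  | ExecIfFalse s s' t b p q :
      ~~ test_fun s b -> exec i q s t s' -> exec i (If b p q) s t.+1 s'
  | ExecWhileFalse s b p : ~~ test_fun s b -> exec i (While b p) s 1 s
  | ExecWhileTrue s1 s2 s3 t1 t2 b p :
      test_fun s1 b -> exec i p s1 t1 s2 -> exec i (While b p) s2 t2 s3 ->
      exec i (While b p) s1 (t1 + t2).+1 s3.

End Semantics.

(* Some program solves the problem in time [T] for some [T] in [o(g)]: on each
   instance [x] of size [N] it halts within [T N] steps in a state correct for
   [x]. *)
Definition solvable_in_o (R : realType) (G : signature) (X : Type)
    (input : X -> access R G) (size_of : X -> nat)
    (correct : X -> state R G -> Prop) (g : nat -> R) : Prop :=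
  exists (p : program G) (T : nat -> nat),
    (fun N => (T N)%:R : R) =o_\oo g /\
    forall x : X, exists t s,
      [/\ exec (input x) p (init_state R G) t s, correct x s
        & (t <= T (size_of x))%N].

(** * k-sum *)

Record ksum_instance (R : realType) (k : nat) := KsumInstance {
  ksum_set : 'I_k -> seq R;
  ksum_uniq : forall i, uniq (ksum_set i) }.

Definition ksum_size (R : realType) k (x : ksum_instance R k) : nat :=
  (\max_(i < k) size (ksum_set x i))%N.

Definition ksum_yes (R : realType) k (x : ksum_instance R k) : Prop :=
  exists t : 'I_k -> R,
    (forall i, t i \in ksum_set x i) /\ \sum_(i < k) t i = 0.

(* The third data type is not used here. *)
Definition ksum_signature (k : nat) : signature :=
  @Signature unit tt void (fun o => match o with end) 'I_k 'I_k void.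

Definition ksum_access (R : realType) k (x : ksum_instance R k) :
    access R (ksum_signature k) :=
  @Access R (ksum_signature k)
    (fun i _ => size (ksum_set x i))
    (fun i js => nth 0 (ksum_set x i) (head 0%N js))
    (fun f => match f with end).

Definition ksum_correct (R : realType) k (x : ksum_instance R k)
    (s : state R (ksum_signature k)) : Prop :=
  nmem s (0%N, [::]) != 0%N <-> ksum_yes x.

Definition ksum_hardness (R : realType) : Prop :=
  forall k : nat, (0 < k)%N ->
    ~ solvable_in_o (@ksum_access R k) (@ksum_size R k) (@ksum_correct R k)
        (fun N => N%:R ^+ uphalf k).

(** * FAQ-AI queries *)

(* The fixed part of a query; multisets of edges are finite families. *)
Record faqai_query := FaqaiQuery {
  nvar : nat;
  dom : 'I_nvar -> countType;
  semiring : comPzSemiRingType;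
  skel_index : finType;
  skel : skel_index -> {set 'I_nvar};
  lig_index : finType;
  lig : lig_index -> {set 'I_nvar};
  finite_skel : {set skel_index};
  free_vars : {set 'I_nvar};
  finite_skel_cover :
    forall v, exists2 K, K \in finite_skel & v \in skel K }.

Section Queries.
Variables (R : realType) (Q : faqai_query).
Local Notation D := (semiring Q).

Definition assignment : choiceType := {dffun forall v : 'I_(nvar Q), dom v}.

Definition tuple_over (K : {set 'I_(nvar Q)}) : choiceType :=
  {dffun forall v : {v : 'I_(nvar Q) | v \in K}, dom (val v)}.

Definition restrict (K : {set 'I_(nvar Q)}) (x : assignment) : tuple_over K :=
  [ffun v : {v : 'I_(nvar Q) | v \in K} => x (val v)].

(* [theta S v] is only relevant when [v] belongs to the ligament edge [S]. *)
Record faqai_input := FaqaiInput {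
  factor : forall K : skel_index Q, tuple_over (skel K) -> D;
  theta : lig_index Q -> forall v : 'I_(nvar Q), dom v -> R;
  support : forall K : skel_index Q, seq (tuple_over (skel K));
  support_finite : forall K, K \in finite_skel Q ->
    uniq (support K) /\ forall x, (x \in support K) = (factor x != 0);
  support_infinite : forall K, K \notin finite_skel Q ->
    support K = [::] /\ infinite_set [set x | factor (K := K) x != 0] }.

Definition faqai_size (I : faqai_input) : nat :=
  (\max_(K in finite_skel Q) size (support I K))%N.

(* The sum has finite support, because [finite_skel] covers the variables. *)
Definition faqai_output (I : faqai_input) (xF : tuple_over (free_vars Q)) : D :=
  \sum_(x \in [set x | restrict (free_vars Q) x = xF])
     ((\prod_(K : skel_index Q) factor I (restrict (skel K) x)) *
      (\prod_(S : lig_index Q)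
         (\sum_(v in lig S) theta I S (x v) <= 0)%R%:R)).

(** ** Access to the input

  Domain elements are represented in the machine by their codes [pickle x].  A
  factor with finite support is read as a list of tuples with values; a factor
  with infinite support can be evaluated at a tuple in one step, and so can the
  functions [theta]. *)

Definition codes (K : {set 'I_(nvar Q)}) (x : tuple_over K) : seq nat :=
  [seq pickle (x v) | v <- enum {: {v : 'I_(nvar Q) | v \in K}}].

Variant faqai_nsym :=
  | FactorSize of skel_index Q
  | FactorEntry of skel_index Q.

Variant faqai_rsym := Theta of lig_index Q & 'I_(nvar Q).

Variant faqai_csym :=
  | SemZero
  | SemOne
  | FactorValue of skel_index Q
  | FactorEval of skel_index Q.

Variant faqai_cop := SemAdd | SemMul.

Definition faqai_signature : signature :=
  @Signature D 0 faqai_cop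
    (fun o => match o with SemAdd => +%R | SemMul => *%R end)
    faqai_nsym faqai_rsym faqai_csym.

Definition faqai_nget (I : faqai_input) (f : faqai_nsym) (a : seq nat) : nat :=
  match f with
  | FactorSize K => size (support I K)
  | FactorEntry K =>
      nth 0%N (nth [::] (map (@codes _) (support I K)) (nth 0%N a 0)) (nth 0%N a 1)
  end.

Definition faqai_rget (I : faqai_input) (f : faqai_rsym) (a : seq nat) : R :=
  match f with
  | Theta L v =>
      if unpickle (head 0%N a) is Some x then theta I L (v := v) x else 0
  end.

(* [codes] is injective, so that the sum below has at most one term. *)
Definition faqai_cget (I : faqai_input) (f : faqai_csym) (a : seq nat) : D :=
  match f with
  | SemZero => 0
  | SemOne => 1
  | FactorValue K => nth 0 (map (@factor I K) (support I K)) (head 0%N a)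
  | FactorEval K =>
      if K \in finite_skel Q then 0
      else \sum_(x \in [set x : tuple_over (skel K) | codes x = a]) factor I x
  end.

Definition faqai_access (I : faqai_input) : access R faqai_signature :=
  @Access R faqai_signature (faqai_nget I) (faqai_rget I) (faqai_cget I).

(* Intended for queries without free variables, where [xF] is the empty tuple. *)
Definition faqai_correct (I : faqai_input) (s : state R faqai_signature) : Prop :=
  forall xF : tuple_over (free_vars Q), cmem s (0%N, [::]) = faqai_output I xF.

Definition answerable_in_o (g : nat -> R) : Prop :=
  solvable_in_o faqai_access faqai_size faqai_correct g.

(** ** Relaxed FAQ-width *)

Definition is_tree (T : finType) (e : rel T) : Prop :=
  [/\ (0 < #|T|)%N, symmetric e, irreflexive e, (forall s t, connect e s t)
    & forall c : seq T, ucycle e c -> (size c <= 2)%N].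

Record relaxed_td := RelaxedTD {
  node : finType;
  tedge : rel node;
  bag : node -> {set 'I_(nvar Q)};
  td_tree : is_tree tedge;
  td_connected : forall v s t, v \in bag s -> v \in bag t ->
    connect [rel a b | [&& tedge a b, v \in bag a & v \in bag b]] s t;
  td_skel : forall K : skel_index Q, exists t, skel K \subset bag t;
  td_lig : forall S : lig_index Q, exists s t,
    tedge s t /\ lig S \subset bag s :|: bag t }.

Definition polymatroid (h : {set 'I_(nvar Q)} -> R) : Prop :=
  [/\ h finset.set0 = 0, forall A, 0 <= h A,
      forall A B : {set 'I_(nvar Q)}, A \subset B -> h A <= h B
    & forall A B, h (A :|: B) + h (A :&: B) <= h A + h B].

Definition edge_dominated (h : {set 'I_(nvar Q)} -> R) : Prop :=
  (forall A, 0 <= h A) /\ forall K, K \in finite_skel Q -> h (skel K) <= 1.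

Definition td_width (T : relaxed_td) : R :=
  sup [set \big[Num.max/0]_(t : node T) h (bag t)
      | h in [set h | polymatroid h /\ edge_dominated h]].

(* The supremum and the infimum are attained: all the sets of widths are
   non-empty and bounded, [finite_skel] covering the variables. *)
Definition faqw : R := inf [set w | exists T : relaxed_td, w = td_width T].

End Queries.

(* Main.v *)
(** The k-sum problem is an FAQ-AI query: one variable per set, ranging over
  positions in it, the indicators of the valid positions as unary factors, and
  two ligament edges, for [sum <= 0] and [- sum <= 0], on all the variables.
  Two adjacent bags of a relaxed tree decomposition cover the [k] variables, so
  one of them has at least [uphalf k] elements, and the cardinality polymatroid
  shows that the width is at least [uphalf k]; two halves of the variables as
  bags attain it.  For [k = 2m] the width is [m].

  A program answering the query becomes, with constant overhead, a program for
  k-sum.  As the machine for k-sum has no semiring memory, the semiring is [R]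
  and its values are kept in the real memory; the output is the number of
  solutions. *)

Require Import Defs.
From mathcomp Require Import all_boot all_order all_algebra.
From mathcomp Require Import all_classical all_reals all_analysis.
From mathcomp Require Import zify.

Set Implicit Arguments.
Unset Strict Implicit.
Unset Printing Implicit Defensive.

Import Order.TTheory GRing.Theory Num.Theory.

Local Open Scope ring_scope.

(** * Encoding of k-sum instances as inputs of one fixed query *)

Section Query.
Variables (R : realType) (k : nat).

Lemma singletons_cover (v : 'I_k) :
  exists2 i : 'I_k, i \in [set: 'I_k]%SET & v \in [set i]%SET.
Proof. by exists v; rewrite ?inE. Qed.

(** The domains belong to the fixed query and cannot depend on the instance, so each is all of
    [nat]; the unary factors cut it down to the valid positions. *)
Definition ksum_query : faqai_query :=
  FaqaiQuery (fun=> nat : countType) R (fun _ : bool => [set: 'I_k]%SET)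
    finset.set0 singletons_cover.

End Query.

Section Instance.
Variables (R : realType) (k : nat) (x : ksum_instance R k).
Local Notation Q := (ksum_query R k).

Definition unary_tuple (i : 'I_k) (j : nat) : tuple_over (Q := Q) [set i]%SET :=
  [ffun=> j].

Definition index_tuples (i : 'I_k) : seq (tuple_over (Q := Q) [set i]%SET) :=
  [seq unary_tuple i j | j <- iota 0 (size (ksum_set x i))].

Lemma size_index_tuples i : size (index_tuples i) = size (ksum_set x i).
Proof. by rewrite /index_tuples size_map size_iota. Qed.

Lemma unary_tuple_inj i : injective (unary_tuple i).
Proof.
by move=> j l /ffunP/(_ (exist _ i (set11 i))); rewrite !ffunE.
Qed.

Definition ksum_factor (i : 'I_k) (t : tuple_over (Q := Q) [set i]%SET) : R :=
  (t \in index_tuples i)%:R.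

Definition ksum_theta (b : bool) (i : 'I_k) (j : nat) : R :=
  if b then nth 0 (ksum_set x i) j else - nth 0 (ksum_set x i) j.

Lemma index_tuples_support i : i \in [set: 'I_k]%SET ->
  uniq (index_tuples i) /\
  forall t, (t \in index_tuples i) = (ksum_factor t != 0).
Proof.
move=> _; split.
  by rewrite map_inj_uniq ?iota_uniq //; exact: unary_tuple_inj.
by move=> t; rewrite /ksum_factor pnatr_eq0 eqb0 negbK.
Qed.

(** Vacuous: every skeleton edge has a factor of finite support. *)
Lemma index_tuples_infinite i : i \notin [set: 'I_k]%SET ->
  index_tuples i = [::] /\
  infinite_set [set t | ksum_factor (i := i) t != 0]%classic.
Proof. by rewrite inE. Qed.

Definition faqai_of_ksum : faqai_input R Q :=
  @FaqaiInput R Q ksum_factor ksum_theta index_tuples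
    index_tuples_support index_tuples_infinite.

Lemma faqai_of_ksum_size : faqai_size faqai_of_ksum = ksum_size x.
Proof.
rewrite /faqai_size /ksum_size /=.
apply: eq_big => [i|i _]; first by rewrite inE.
exact: size_index_tuples.
Qed.

(** [pickle] is the identity on [nat], and a tuple over a singleton has one coordinate. *)
Lemma codes_unary i j : codes (unary_tuple i j) = [:: j].
Proof.
rewrite /codes.
rewrite (eq_map (g := fun=> j)) => [|v]; last by rewrite ffunE.
have : size (enum {: {v : 'I_k | v \in [set i]%SET}}) = 1%N.
  by rewrite -cardE card_sig -[RHS](cards1 i); apply: eq_card => v; rewrite inE.
by case: (enum _) => [|v []].
Qed.

Lemma codes_index_tuples i :
  map (@codes Q [set i]%SET) (index_tuples i) =
  [seq [:: j] | j <- iota 0 (size (ksum_set x i))].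
Proof.
by rewrite /index_tuples -map_comp; apply: eq_map => j; exact: codes_unary.
Qed.

Lemma factor_index_tuples i :
  map (@ksum_factor i) (index_tuples i) = nseq (size (ksum_set x i)) 1.
Proof.
rewrite -size_index_tuples -[in RHS](size_map (@ksum_factor i)).
apply/all_pred1P/allP => _ /mapP[t it ->] /=.
by rewrite /ksum_factor it.
Qed.

(** Row [j] of the list is [[:: j]], and reading outside the list or the row gives the default 0. So
    the k-sum machine can answer this access from the size of the set alone. *)
Lemma factor_entryE i a : faqai_nget faqai_of_ksum (FactorEntry (Q := Q) i) a =
  if (size (ksum_set x i) <= nth 0%N a 0)%N || (0 < nth 0%N a 1)%N then 0%N
  else nth 0%N a 0.
Proof.
rewrite [LHS](congr1 (fun s => nth 0%N (nth [::] s _) _)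
  (codes_index_tuples i)).
have [ia|ia] /= := leqP (size (ksum_set x i)) (nth 0%N a 0).
  by rewrite (nth_default [::]) ?nth_nil ?size_map ?size_iota.
rewrite (nth_map 0%N) ?size_iota // nth_iota // add0n.
by case: (nth 0%N a 1) => [|[]].
Qed.

Lemma factor_valueE i a : faqai_cget faqai_of_ksum (FactorValue (Q := Q) i) a =
  (head 0%N a < size (ksum_set x i))%N%:R.
Proof.
rewrite [LHS](congr1 (fun s => nth 0 s _) (factor_index_tuples i)) nth_nseq.
by case: ifP.
Qed.

(** Direct evaluation returns 0 on factors of finite support, and all factors here are such. *)
Lemma factor_evalE i a :
  faqai_cget faqai_of_ksum (FactorEval (Q := Q) i) a = 0.
Proof. by rewrite /= inE. Qed.

End Instance.

(* Index array [a] is kept in array [a.+2]; real array [a] in [a.*2.+2] and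
   semiring array [a] in [a.*2.+3], both in the real memory. *)
Definition ncell (c : cell) : cell := (c.1.+2, [seq z.+2 | z <- c.2]).
Definition rcell (c : cell) : cell := (c.1.*2.+2, [seq z.+2 | z <- c.2]).
Definition ccell (c : cell) : cell := (c.1.*2.+3, [seq z.+2 | z <- c.2]).
(** The shifts free arrays 0 and 1 of both memories, one for scratch values and one for a constant
    zero. [nscratch] is also the cell from which the k-sum answer is read. *)
Definition nscratch : cell := (0%N, [::]).
Definition nzero : cell := (1%N, [::]).
Definition rzero : cell := (0%N, [::]).
Definition rscratch : cell := (1%N, [::]).

(** * Translation of query programs into k-sum programs *)

Section Translation.
Variables (R : realType) (k : nat).
Local Notation Q := (ksum_query R k).
Local Notation F := (faqai_signature Q).
Local Notation K := (ksum_signature k).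

(* A semiring equality [d = e] is tested as [(d - e) ^ 2 <= 0], because the
   condition of a loop is a single real comparison. *)
Definition test_setup (b : test) : program K :=
  match b with
  | CEq d e => Seq (ROp RSub rscratch (ccell d) (ccell e))
                   (ROp RMul rscratch rscratch rscratch)
  | _ => Skip
  end.

Definition translate_test (b : test) : test :=
  match b with
  | NLe d e => NLe (ncell d) (ncell e)
  | RLe d e => RLe (rcell d) (rcell e)
  | CEq _ _ => RLe rscratch rzero
  end.

(** A missing argument becomes the zero cell, in agreement with the default 0 in the access
    functions. *)
Definition argument (ds : seq cell) (n : nat) : cell :=
  nth nzero (map ncell ds) n.

(** An entry is computed in the scratch cell, since the destination may coincide with an argument
    still to be read. *)
Definition translate_nget (c : cell) (f : nsym F) (ds : seq cell) : program K :=
  match f with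
  | FactorSize i => NGet (G := K) (ncell c) i [::]
  | FactorEntry i =>
      Seq (NGet (G := K) nscratch i [::])
     (Seq (If (NLe nscratch (argument ds 0)) (NConst nscratch 0)
          (If (NLe (argument ds 1) nzero)
              (NOp NAdd nscratch (argument ds 0) nzero)
              (NConst nscratch 0)))
          (NOp NAdd (ncell c) nscratch nzero))
  end.

Definition translate_rget (c : cell) (f : rsym F) (ds : seq cell) : program K :=
  match f with
  | Theta b i =>
      let get := RGet (G := K) (rcell c) i (map ncell ds) in
      if b then get else Seq get (ROp RSub (rcell c) rzero (rcell c))
  end.

Definition translate_cget (c : cell) (f : csym F) (ds : seq cell) : program K :=
  match f with
  | SemZero | FactorEval _ => RCast (ccell c) nzero
  | SemOne => Seq (NConst nscratch 1) (RCast (ccell c) nscratch)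
  | FactorValue i =>
      Seq (NGet (G := K) nscratch i [::])
     (Seq (If (NLe nscratch (argument ds 0)) (NConst nscratch 0)
              (NConst nscratch 1))
          (RCast (ccell c) nscratch))
  end.

(** For a loop the set-up of the test comes both before the loop and at the end of its body, hence
    just before each evaluation of the condition. *)
Fixpoint translate (p : program F) : program K :=
  match p with
  | Skip => Skip
  | NConst c n => NConst (ncell c) n
  | NOp o c d e => NOp o (ncell c) (ncell d) (ncell e)
  | NGet c f ds => translate_nget c f ds
  | RCast c d => RCast (rcell c) (ncell d)
  | ROp o c d e => ROp o (rcell c) (rcell d) (rcell e)
  | RGet c f ds => translate_rget c f ds
  | COp SemAdd c d e => ROp RAdd (ccell c) (ccell d) (ccell e)
  | COp SemMul c d e => ROp RMul (ccell c) (ccell d) (ccell e)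
  | CGet c f ds => translate_cget c f ds
  | Seq p q => Seq (translate p) (translate q)
  | If b p q =>
      Seq (test_setup b) (If (translate_test b) (translate p) (translate q))
  | While b p =>
      Seq (test_setup b)
          (While (translate_test b) (Seq (translate p) (test_setup b)))
  end.

(** * Simulation of query programs with constant overhead *)

Record simulates (s : state R F) (s' : state R K) : Prop := Simulates {
  sim_nmem : forall a js, nmem s' (a.+2, js) = nmem s (a, js);
  sim_rmem : forall a js, rmem s' (a.*2.+2, js) = rmem s (a, js);
  sim_cmem : forall a js, rmem s' (a.*2.+3, js) = cmem s (a, js);
  sim_nzero : nmem s' nzero = 0%N;
  sim_rzero : rmem s' rzero = 0 }.

Lemma simulates_init : simulates (init_state R F) (init_state R K).
Proof. by []. Qed.

Section Simulates.
Variables (s : state R F) (s' : state R K).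
Hypothesis ss' : simulates s s'.

(** Coordinates name scalar index variables, which are themselves moved by two; this is why the cell
    maps also shift the second component. *)
Lemma sim_coords (xs : seq nat) :
  [seq nmem s' (z, [::]) | z <- [seq z.+2 | z <- xs]] =
  [seq nmem s (z, [::]) | z <- xs].
Proof. by rewrite -map_comp; apply: eq_map => z /=; rewrite (sim_nmem ss'). Qed.

Lemma addr_ncell c : addr s' (ncell c) = ((addr s c).1.+2, (addr s c).2).
Proof. by rewrite /addr /= sim_coords. Qed.

Lemma addr_rcell c : addr s' (rcell c) = ((addr s c).1.*2.+2, (addr s c).2).
Proof. by rewrite /addr /= sim_coords. Qed.

Lemma addr_ccell c : addr s' (ccell c) = ((addr s c).1.*2.+3, (addr s c).2).
Proof. by rewrite /addr /= sim_coords. Qed.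

Lemma nval_ncell c : nval s' (ncell c) = nval s c.
Proof. by rewrite /nval addr_ncell (sim_nmem ss') -surjective_pairing. Qed.

Lemma rval_rcell c : rval s' (rcell c) = rval s c.
Proof. by rewrite /rval addr_rcell (sim_rmem ss') -surjective_pairing. Qed.

Lemma rval_ccell c : rval s' (ccell c) = cval s c.
Proof. by rewrite /rval addr_ccell (sim_cmem ss') -surjective_pairing. Qed.

Lemma nval_nzero : nval s' nzero = 0%N.
Proof. exact: (sim_nzero ss'). Qed.

Lemma rval_rzero : rval s' rzero = 0.
Proof. exact: (sim_rzero ss'). Qed.

Lemma nval_argument ds n :
  nval s' (argument ds n) = nth 0%N (map (nval s) ds) n.
Proof.
rewrite /argument; have [nds|dsn] := ltnP n (size ds).
  by rewrite !(nth_map nzero) // nval_ncell.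
by rewrite !nth_default ?size_map // nval_nzero.
Qed.

Lemma nval_ncells ds : map (nval s') (map ncell ds) = map (nval s) ds.
Proof. by rewrite -map_comp; apply: eq_map => d; exact: nval_ncell. Qed.

Lemma simulates_nset c n : simulates (nset s c n) (nset s' (ncell c) n).
Proof.
by split=> * /=; rewrite /upd ?addr_ncell ?(sim_nmem ss') ?(sim_rmem ss')
  ?(sim_cmem ss') ?(sim_nzero ss') ?(sim_rzero ss').
Qed.

(** Real arrays get even numbers and semiring arrays odd ones, so parity excludes interference;
    likewise for [simulates_cset]. *)
Lemma simulates_rset c z : simulates (rset s c z) (rset s' (rcell c) z).
Proof.
split=> [a js|a js|a js||] /=; rewrite /upd ?addr_rcell.
- exact: (sim_nmem ss').
- by rewrite !xpair_eqE !eqSS (inj_eq double_inj) (sim_rmem ss').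
- rewrite (sim_cmem ss') xpair_eqE !eqSS; case: eqP => // /(congr1 odd).
  by rewrite /= !odd_double.
- exact: (sim_nzero ss').
- exact: (sim_rzero ss').
Qed.

Lemma simulates_cset c (z : R) :
  simulates (cset (G := F) s c z) (rset s' (ccell c) z).
Proof.
split=> [a js|a js|a js||] /=; rewrite /upd ?addr_ccell.
- exact: (sim_nmem ss').
- rewrite (sim_rmem ss') xpair_eqE !eqSS; case: eqP => // /(congr1 odd).
  by rewrite /= !odd_double.
- by rewrite !xpair_eqE !eqSS (inj_eq double_inj) (sim_cmem ss').
- exact: (sim_nzero ss').
- exact: (sim_rzero ss').
Qed.

(** [simulates] does not constrain the scratch cells, so intermediate results can be stored there at
    any time. *)
Lemma simulates_nscratch n : simulates s (nset s' nscratch n).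
Proof. by case: ss'. Qed.

Lemma simulates_rscratch z : simulates s (rset s' rscratch z).
Proof. by case: ss'. Qed.

End Simulates.

Lemma nset_nset (s : state R K) m n :
  nset (nset s nscratch m) nscratch n = nset s nscratch n.
Proof.
rewrite /nset /= /upd /addr /=; congr State; apply: funext => d.
by case: eqP.
Qed.

Lemma rset_rset (s : state R K) c y z : rset (rset s c y) c z = rset s c z.
Proof.
rewrite /rset /=; congr State; apply: funext => d; rewrite /upd.
by case: eqP.
Qed.

Lemma nval_nscratch (s : state R K) n : nval (nset s nscratch n) nscratch = n.
Proof. by rewrite /nval /= /upd eqxx. Qed.

Lemma rval_rset (s : state R K) c z : rval (rset s c z) c = z.
Proof. by rewrite /rval /= /upd /addr /= eqxx. Qed.

Lemma test_setupP (i : access R K) b s s' : simulates s s' ->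
  exists t u, [/\ exec i (test_setup b) s' t u, simulates s u, (t <= 2)%N
    & test_fun u (translate_test b) = test_fun s b].
Proof.
move=> ss'; case: b => d e /=.
- exists 1%N, s'; split => //; first exact: ExecSkip.
  by rewrite !(nval_ncell ss').
- exists 1%N, s'; split => //; first exact: ExecSkip.
  by rewrite !(rval_rcell ss').
- set u := rset (rset s' rscratch (cval s d - cval s e)) rscratch
    ((cval s d - cval s e) * (cval s d - cval s e) : R).
  have su : simulates s u by do 2!apply: simulates_rscratch.
  exists 2%N, u; split=> //.
  + rewrite -[2%N]/(1 + 1)%N; apply: ExecSeq; first exact: ExecROp.
    have -> : u = rset (rset s' rscratch (rop_fun RSub (rval s' (ccell d))
        (rval s' (ccell e)))) rscratch (rop_fun RMul
        (cval s d - cval s e) (cval s d - cval s e)).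
      by rewrite !(rval_ccell ss').
    rewrite -[X in rop_fun RMul X X](rval_rset s' rscratch) -!(rval_ccell ss').
    exact: ExecROp.
  rewrite (rval_rzero su) rval_rset.
  by rewrite -expr2 real_exprn_even_le0 ?num_real //= subr_eq0.
Qed.

(** The machine has no copy instruction; adding the zero cell replaces it. *)
Lemma exec_ncopy (i : access R K) s s' c d : simulates s s' ->
  exec i (NOp NAdd c d nzero) s' 1 (nset s' c (nval s' d)).
Proof.
move=> ss'; rewrite -[X in nset _ _ X]addn0 -[X in (_ + X)%N](nval_nzero ss').
exact: ExecNOp.
Qed.

Lemma translate_cget_exec (x : ksum_instance R k) c (f : csym F) ds s s' :
  simulates s s' ->
  exists t' u', [/\ exec (ksum_access x) (translate_cget c f ds) s' t' u',
    simulates (cset s c (cget (faqai_access (faqai_of_ksum x)) f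
                          (map (nval s) ds))) u' & (t' <= 8)%N].
Proof.
move=> ss'; case: f => [||i|i].
- do 2!eexists; split; first exact: ExecRCast.
    by rewrite (nval_nzero ss'); exact: simulates_cset.
  by [].
- do 2!eexists; split.
  + by apply: ExecSeq; [exact: ExecNConst | exact: ExecRCast].
  + by rewrite nval_nscratch; apply/simulates_cset/simulates_nscratch.
  + by [].
- have sn n : simulates s (nset s' nscratch n) by exact: simulates_nscratch.
  have ds0 : nth 0%N (map (nval s) ds) 0 = head 0%N (map (nval s) ds).
    by rewrite nth0.
  rewrite [cget _ _ _]factor_valueE -ds0.
  set n := size (ksum_set x i).
  exists 4%N, (rset (nset s' nscratch (nth 0 (map (nval s) ds) 0 < n)%N)
     (ccell c) (nth 0 (map (nval s) ds) 0 < n)%N%:R).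
  split; [|exact: simulates_cset | by []].
  rewrite -[4%N]/(1 + (2 + 1))%N; apply: ExecSeq; first exact: ExecNGet.
  apply: ExecSeq; last first.
    rewrite -[X in X%:R](nval_nscratch s'); exact: ExecRCast.
  (* The scratch cell receives the size first and then the bit; only the last write remains. *)
  rewrite -(nset_nset s' n (nth 0 (map (nval s) ds) 0 < n)%N); case: ltnP => nd.
    apply: ExecIfFalse; last exact: ExecNConst.
    by rewrite /test_fun nval_nscratch (nval_argument (sn _)) -ltnNge.
  apply: ExecIfTrue; last exact: ExecNConst.
  by rewrite /test_fun nval_nscratch (nval_argument (sn _)).
- rewrite [cget _ _ _]factor_evalE.
  do 2!eexists; split; first exact: ExecRCast.
    by rewrite (nval_nzero ss'); exact: simulates_cset.
  by [].
Qed.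

Lemma translate_nget_exec (x : ksum_instance R k) c (f : nsym F) ds s s' :
  simulates s s' ->
  exists t' u', [/\ exec (ksum_access x) (translate_nget c f ds) s' t' u',
    simulates (nset s c (nget (faqai_access (faqai_of_ksum x)) f
                          (map (nval s) ds))) u' & (t' <= 8)%N].
Proof.
move=> ss'; case: f => i.
  do 2!eexists; split; first exact: ExecNGet.
    rewrite [nget _ _ _](size_index_tuples x i); exact: simulates_nset.
  by [].
have sn n : simulates s (nset s' nscratch n) by exact: simulates_nscratch.
rewrite [nget _ _ _]factor_entryE.
set n := size (ksum_set x i); set v := if _ then _ else _.
have [t [te t3]] : exists t, exec (ksum_access x)
    (If (NLe nscratch (argument ds 0)) (NConst nscratch 0)
    (If (NLe (argument ds 1) nzero)
        (NOp NAdd nscratch (argument ds 0) nzero)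
        (NConst nscratch 0))) (nset s' nscratch n) t
    (nset (nset s' nscratch n) nscratch v) /\
    (t <= 3)%N.
  rewrite /v; have [nd|nd] := leqP n (nth 0%N (map (nval s) ds) 0);
    rewrite ?orTb ?orFb.
    exists 2%N; split=> //; apply: ExecIfTrue; last exact: ExecNConst.
    by rewrite /test_fun nval_nscratch (nval_argument (sn _)).
  exists 3%N; split=> //; apply: ExecIfFalse.
    by rewrite /test_fun nval_nscratch (nval_argument (sn _)) -ltnNge.
  case: posnP => d1.
    apply: ExecIfTrue.
      by rewrite /test_fun (nval_nzero (sn _)) (nval_argument (sn _)) d1.
    by rewrite -(nval_argument (sn n)); exact: exec_ncopy (sn n).
  apply: ExecIfFalse; last exact: ExecNConst.
  by rewrite /test_fun (nval_nzero (sn _)) (nval_argument (sn _)) -ltnNge.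
exists (1 + (t + 1))%N, (nset (nset s' nscratch v) (ncell c) v).
split; [|exact: simulates_nset|by rewrite addn1 add1n !ltnS (leq_trans t3)].
apply: ExecSeq; first exact: ExecNGet.
apply: ExecSeq; first exact: te.
rewrite nset_nset -[X in nset _ (ncell c) X](nval_nscratch s').
exact: exec_ncopy (sn v).
Qed.

Lemma translate_rget_exec (x : ksum_instance R k) c (f : rsym F) ds s s' :
  simulates s s' ->
  exists t' u', [/\ exec (ksum_access x) (translate_rget c f ds) s' t' u',
    simulates (rset s c (rget (faqai_access (faqai_of_ksum x)) f
                          (map (nval s) ds))) u' & (t' <= 8)%N].
Proof.
move=> ss'; case: f => [[] i].
  do 2!eexists; split; first exact: ExecRGet.
    rewrite (nval_ncells ss'); exact: simulates_rset.
  by [].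
set a := nth 0 (ksum_set x i) (head 0%N (map (nval s) ds)).
have sa : simulates (rset s c a) (rset s' (rcell c) a) by exact: simulates_rset.
exists 2%N, (rset (rset s' (rcell c) a) (rcell c) (- a)); split=> //.
  rewrite -[2%N]/(1 + 1)%N; apply: (ExecSeq (s2 := rset s' (rcell c) a)).
    by rewrite /a -(nval_ncells ss'); exact: ExecRGet.
  rewrite -[- a]sub0r -[X in X - _](rval_rzero sa).
  rewrite -[X in _ - X](rval_rset s' (rcell c)).
  exact: ExecROp.
rewrite rset_rset; exact: simulates_rset.
Qed.

(** Induction on the execution. An elementary instruction becomes at most 5 steps and a test costs
    at most 2 more for its set-up, so the factor 8 is a generous uniform bound. *)
Lemma translate_exec (x : ksum_instance R k) p s t u s' :
  exec (faqai_access (faqai_of_ksum x)) p s t u -> simulates s s' ->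
  exists t' u', [/\ exec (ksum_access x) (translate p) s' t' u',
    simulates u u' & (t' <= 8 * t)%N].
Proof.
move=> e; elim: e s' => {p s t u}.
- by move=> s s' ss'; exists 1%N, s'; split=> //; exact: ExecSkip.
- move=> s c n s' ss'; do 2!eexists; split; first exact: ExecNConst.
    exact: simulates_nset.
  by [].
- move=> s o c d e s' ss'; do 2!eexists; split; first exact: ExecNOp.
    rewrite !(nval_ncell ss'); exact: simulates_nset.
  by [].
- by move=> s c f ds s'; exact: translate_nget_exec.
- move=> s c d s' ss'; do 2!eexists; split; first exact: ExecRCast.
    rewrite (nval_ncell ss'); exact: simulates_rset.
  by [].
- move=> s o c d e s' ss'; do 2!eexists; split; first exact: ExecROp.
    rewrite !(rval_rcell ss'); exact: simulates_rset.
  by [].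
- by move=> s c f ds s'; exact: translate_rget_exec.
- move=> s [] c d e s' ss'; (do 2!eexists; split; first exact: ExecROp);
    by rewrite ?(rval_ccell ss') //; exact: simulates_cset.
- by move=> s c f ds s'; exact: translate_cget_exec.
- move=> s1 s2 s3 t1 t2 p q _ IHp _ IHq s1' /IHp[t1' [s2' [e1 /IHq H t1l]]].
  have [t2' [s3' [e2 s3s t2l]]] := H.
  exists (t1' + t2')%N, s3'; split=> //; first exact: ExecSeq e1 e2.
  by rewrite mulnDr leq_add.
- move=> s u t b p q bs _ IH s' ss'.
  have [t0 [s0 [e0 ss0 t0l tb]]] := test_setupP (ksum_access x) b ss'.
  have [t' [u' [e' uu' tl]]] := IH _ ss0.
  exists (t0 + t'.+1)%N, u'; split=> //.
    by apply: ExecSeq e0 _; apply: ExecIfTrue e'; rewrite tb.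
  lia.
- move=> s u t b p q bs _ IH s' ss'.
  have [t0 [s0 [e0 ss0 t0l tb]]] := test_setupP (ksum_access x) b ss'.
  have [t' [u' [e' uu' tl]]] := IH _ ss0.
  exists (t0 + t'.+1)%N, u'; split=> //.
    by apply: ExecSeq e0 _; apply: ExecIfFalse e'; rewrite tb.
  lia.
- move=> s b p bs s' ss'.
  have [t0 [s0 [e0 ss0 t0l tb]]] := test_setupP (ksum_access x) b ss'.
  exists (t0 + 1)%N, s0; split=> //.
    by apply: ExecSeq e0 _; apply: ExecWhileFalse; rewrite tb.
  lia.
- move=> s1 s2 s3 t1 t2 b p bs _ IHp _ IHw s1' ss1.
  have [t0 [s0 [e0 ss0 t0l tb]]] := test_setupP (ksum_access x) b ss1.
  have [t1' [s2' [e1 ss2 t1l]]] := IHp _ ss0.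
  have [t2' [s3' [e2 ss3 t2l]]] := IHw _ ss2.
  (* The translated rest of the loop starts with its own set-up; splitting it off lets it serve as
     the end of the current round. *)
  inversion e2; subst.
  exists (t0 + (t1' + t3 + t4).+1)%N, s3'; split=> //; last lia.
  apply: ExecSeq e0 _; apply: ExecWhileTrue; first by rewrite tb.
    by apply: ExecSeq e1 _; eassumption.
  by [].
Qed.

End Translation.

(** * The query output as the number of solutions *)

Section Output.
Variables (R : realType) (k : nat) (x : ksum_instance R k).
Local Notation Q := (ksum_query R k).

Definition solution_indices (y : assignment Q) : bool :=
  [forall i, (y i < size (ksum_set x i))%N] &&
  (\sum_(i < k) nth 0 (ksum_set x i) (y i) == 0).

Lemma restrict_index_tuples (y : assignment Q) (i : 'I_k) :
  (Defs.restrict (Q := Q) [set i]%SET y \in index_tuples x i) =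
  (y i < size (ksum_set x i))%N.
Proof.
have -> : Defs.restrict (Q := Q) [set i]%SET y = unary_tuple R i (y i).
  by apply/ffunP => v; rewrite !ffunE; case: v => v /= /set1P ->.
by rewrite mem_map ?mem_iota //; exact: unary_tuple_inj.
Qed.

Lemma prodr_bool (I : finType) (b : pred I) :
  \prod_i (b i)%:R = [forall i, b i]%:R :> R.
Proof.
case: forallP => [bT|/forallP]; first by rewrite big1 // => i _; rewrite bT.
rewrite negb_forall => /existsP[i /negbTE bi].
by rewrite (bigD1 i) //= bi mul0r.
Qed.

Lemma faqai_termE (y : assignment Q) :
  (\prod_(i : 'I_k) Defs.factor (faqai_of_ksum x)
                       (Defs.restrict (Q := Q) [set i]%SET y)) *
  (\prod_(b : bool) (\sum_(v in [set: 'I_k]%SET)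
     theta (faqai_of_ksum x) b (y v) <= 0)%R%:R) = (solution_indices y)%:R :> R.
Proof.
rewrite -[in RHS]mulnb natrM -!prodr_bool; congr (_ * _).
  apply: eq_bigr => i _; congr (nat_of_bool _)%:R; exact: restrict_index_tuples.
rewrite prodr_bool; congr (nat_of_bool _)%:R; apply/forallP/eqP => [le0|eq0 b].
  (* The two ligament inequalities bound the sum from above and from below by 0. *)
  apply: le_anti; move: (le0 true) (le0 false) => /=.
  under eq_bigl do rewrite inE; move=> -> /=.
  by under eq_bigl do rewrite inE; rewrite sumrN oppr_le0.
under eq_bigl do rewrite inE.
by case: b; rewrite /= /ksum_theta ?sumrN eq0 ?oppr0.
Qed.

(** Variables range over all of [nat], but in a solution they stay below the set sizes, so solutions
    come from a finite function space. *)
Lemma finite_solution_indices :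
  finite_set [set y : assignment Q | solution_indices y]%classic.
Proof.
set M := ksum_size x.
(* [M.+1] instead of [M] because [inord] needs a non-empty ordinal type. *)
pose f (z : {ffun 'I_k -> 'I_M.+1}) : assignment Q :=
  [ffun i => nat_of_ord (z i)].
apply: sub_finite_set (finite_image f (finite_finset (X := setT))).
move=> y /= /andP[/forallP yx _].
exists [ffun i => inord (y i)] => //; apply/ffunP => i.
rewrite !ffunE inordK //.
rewrite ltnS (leq_trans (ltnW (yx i))) //.
exact: (leq_bigmax (F := fun i => size (ksum_set x i))).
Qed.

Lemma faqai_of_ksum_output_gt0 (xF : tuple_over (free_vars Q)) :
  0 < (faqai_output (faqai_of_ksum x) xF : R) <-> ksum_yes x.
Proof.
have -> : faqai_output (faqai_of_ksum x) xF =
    \sum_(y \in [set y : assignment Q | solution_indices y]%classic)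
      ((solution_indices y)%:R : R).
  rewrite /faqai_output; under eq_fsbigr => y _ do rewrite faqai_termE.
  (* Terms outside the solutions vanish, and every assignment restricts to the unique tuple over the
     empty set. *)
  apply/esym/fsbig_widen => [y _|y [_ /negP/negbTE] /= ->] //.
  by apply/ffunP => -[v v0]; exfalso; rewrite finset.in_set0 in v0.
split=> [/(fsumr_gt0 [::])[y /= /andP[/forallP yx /eqP s0] _]|[t [tx s0]]].
  exists (fun i => nth 0 (ksum_set x i) (y i)); split=> // i.
  exact: mem_nth.
pose y : assignment Q := [ffun i => index (t i) (ksum_set x i)].
have yT : solution_indices y.
  apply/andP; split.
    by apply/forallP => i; rewrite ffunE index_mem.
  rewrite -[X in _ == X]s0; apply/eqP; apply: eq_bigr => i _.
  by rewrite ffunE nth_index.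
rewrite lt_def fsumr_ge0 ?andbT //.
(* A zero sum of nonnegative terms would make each term zero, but the term of [y] is 1. *)
apply/eqP => s1.
have := pfsumr_eq0 finite_solution_indices (fun y _ => ler0n R _) s1 yT.
by rewrite yT; apply/eqP; rewrite oner_eq0.
Qed.

End Output.

(** * The relaxed width of the query *)

Section Width.
Variables (R : realType) (k : nat).
Local Notation Q := (ksum_query R k).

(** Singletons are skeleton edges, so [h] is at most 1 on them; submodularity and nonnegativity make
    [h] subadditive. *)
Lemma polymatroid_le_card (h : {set 'I_k} -> R) (A : {set 'I_k}) :
  polymatroid (Q := Q) h -> edge_dominated (Q := Q) h -> h A <= #|A|%:R.
Proof.
move=> [h0 h_ge0 _ hUI] [_ h1]; move eqn : #|A| => n.
elim: n A eqn => [|n IHn] A.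
  by move/cards0_eq ->; rewrite [h _]h0.
have [->|[a aA]] := set_0Vmem A; first by rewrite cards0.
rewrite (cardsD1 a) aA add1n => -[/IHn hAa].
rewrite -(finset.setD1K aA) -[n.+1]add1n natrD.
apply: le_trans (lerD (h1 a (finset.in_setT a)) hAa).
by apply: le_trans (hUI _ _); rewrite lerDl.
Qed.

Lemma polymatroid_card : polymatroid (Q := Q) (fun A => #|A|%:R : R).
Proof.
split=> [|A|A B AB|A B]; first by rewrite cards0.
- exact: ler0n.
- by rewrite ler_nat subset_leq_card.
- by rewrite -!natrD cardsUI.
Qed.

Lemma edge_dominated_card : edge_dominated (Q := Q) (fun A => #|A|%:R : R).
Proof. by split=> [A|i _]; rewrite ?ler0n // [skel _]/= cards1. Qed.

Lemma le_td_width (T : relaxed_td Q) (t : node T) : #|bag t|%:R <= td_width R T.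
Proof.
apply: (@le_trans _ _ (\big[Num.max/0]_(t : node T) (#|bag t|%:R : R))).
  exact: (le_bigmax _ (fun t => #|bag t|%:R : R)).
apply: ub_le_sup; last first.
  by exists (fun A : {set 'I_k} => #|A|%:R) => //; split;
    [exact: polymatroid_card | exact: edge_dominated_card].
(* A member is below [sup] only if the set is bounded above; [k] is such a bound. *)
exists k%:R => _ /= [h [hp he] <-]; apply: bigmax_le => // u _.
apply: le_trans (polymatroid_le_card _ hp he) _.
by rewrite ler_nat -[leqRHS]card_ord max_card.
Qed.

Lemma td_width_ge (T : relaxed_td Q) : (uphalf k)%:R <= td_width R T.
Proof.
have [s [t [_ st]]] := td_lig T true.
have kst : (k <= #|bag s| + #|bag t|)%N.
  rewrite -[leqLHS]card_ord -cardsT (leq_trans (subset_leq_card st)) //.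
  by rewrite -cardsUI leq_addr.
have : (uphalf k <= maxn #|bag s| #|bag t|)%N by lia.
rewrite leq_max => /orP[ks|kt].
  by apply: le_trans (le_td_width s); rewrite ler_nat.
by apply: le_trans (le_td_width t); rewrite ler_nat.
Qed.

Definition half_bag (b : bool) : {set 'I_(nvar Q)} :=
  [set v : 'I_k | (v < uphalf k)%N == b]%SET.

Lemma card_half_bag b : (#|half_bag b| <= uphalf k)%N.
Proof.
have cT : #|half_bag true| = uphalf k.
  rewrite -sum1dep_card (eq_bigl (fun v : 'I_k => v < uphalf k)%N) => [|v].
    by rewrite -(big_ord_widen k (fun=> 1%N)) ?sum1_card ?card_ord //; lia.
  by rewrite eqb_id.
case: b; rewrite ?cT //.
have -> : half_bag false = ~: half_bag true.
  by apply/setP => v; rewrite !inE; case: (_ < _)%N.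
rewrite cardsCs finset.setCK cT card_ord /=; lia.
Qed.

(** The tree with one edge: a repetition-free cycle in [bool] has at most two entries. *)
Lemma is_tree_bool : is_tree (fun a b : bool => a != b).
Proof.
split=> [|a b|a|a b|c /andP[_ /card_uniqP <-]]; rewrite ?card_bool ?eqxx //.
- by rewrite eq_sym.
- by have [->|ab] := eqVneq a b; [exact: connect0 | exact: connect1].
- by rewrite -[leqRHS]card_bool max_card.
Qed.

(** The two bags are disjoint, so [s] and [t] coincide. *)
Lemma half_bag_connected (v : 'I_(nvar Q)) s t :
  v \in half_bag s -> v \in half_bag t ->
  connect [rel a b | [&& a != b, v \in half_bag a & v \in half_bag b]] s t.
Proof. by rewrite !inE => /eqP <- /eqP <-. Qed.

Lemma half_bag_skel (i : skel_index Q) : exists b, skel i \subset half_bag b.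
Proof. by exists (i < uphalf k)%N; rewrite finset.sub1set inE. Qed.

Lemma half_bag_lig (b : lig_index Q) :
  exists s t, s != t /\ lig b \subset half_bag s :|: half_bag t.
Proof.
exists true, false; split=> //; apply/fintype.subsetP => v _; rewrite !inE.
by case: (_ < _)%N.
Qed.

Definition half_td : relaxed_td Q :=
  RelaxedTD is_tree_bool half_bag_connected half_bag_skel half_bag_lig.

Lemma td_width_half_td : td_width R half_td <= (uphalf k)%:R.
Proof.
apply: ge_sup.
  by eexists; exists (fun A : {set 'I_k} => #|A|%:R) => //; split;
    [exact: polymatroid_card | exact: edge_dominated_card].
move=> _ /= [h [hp he] <-]; apply: bigmax_le => // b _.
apply: le_trans (polymatroid_le_card _ hp he) _.
by rewrite ler_nat card_half_bag.
Qed.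

Lemma faqw_ksum_query : faqw R Q = (uphalf k)%:R.
Proof.
apply/le_anti/andP; split.
  apply: le_trans td_width_half_td; apply: ge_inf; last by exists half_td.
  by exists (uphalf k)%:R => _ [T ->]; exact: td_width_ge.
apply: lb_le_inf; first by exists (td_width R half_td), half_td.
by move=> _ [T ->]; exact: td_width_ge.
Qed.

End Width.

(** * Transfer of the running time and conclusion *)

Local Open Scope classical_set_scope.

(** The factor [a] is absorbed by a smaller epsilon for [T], the constant [b] by the growth of
    [n ^ k], as [k] is positive. *)
Lemma littleo_affine (R : realType) (k a b : nat) (T : nat -> nat) :
  (0 < k)%N ->
  (fun n : nat => (T n)%:R : R) =o_\oo (fun n : nat => n%:R ^+ k : R) ->
  (fun n : nat => (a * T n + b)%:R : R) =o_\oo (fun n : nat => n%:R ^+ k : R).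
Proof.
move=> k0 /eqoP To; apply/eqoP => e e0.
(* Half of [e] goes to [a * T n] and half to [b]; [a.+1] avoids division by zero. *)
have ea0 : 0 < e / 2 / a.+1%:R by rewrite !divr_gt0 ?ltr0n.
near=> n.
have n0 : (0 < n)%N by near: n; exact: nbhs_infty_gt.
have nn : (n%:R : R) <= n%:R ^+ k.
  by rewrite -natrX ler_nat -[leqLHS]expn1 leq_pexp2l.
have Tn : `|(T n)%:R : R| <= e / 2 / a.+1%:R * `|n%:R ^+ k|.
  by near: n; exact: To.
have bn : (b%:R : R) <= e / 2 * n%:R.
  rewrite -ler_pdivrMl ?divr_gt0 //; near: n; exact: nbhs_infty_ger.
move: Tn; rewrite !normr_nat normrX normr_nat => Tn.
rewrite natrD natrM [e in leRHS]splitr mulrDl lerD //; last first.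
  by apply: le_trans bn _; rewrite ler_pM2l ?divr_gt0.
apply: (@le_trans _ _ (a.+1%:R * (T n)%:R)).
  by rewrite ler_wpM2r ?ler0n // ler_nat.
by rewrite mulrC -ler_pdivlMr ?ltr0n // mulrAC.
Unshelve. all: by end_near.
Qed.

Local Close Scope classical_set_scope.

Lemma ksum_of_answerable (R : realType) (k : nat) : (0 < k)%N ->
  answerable_in_o (ksum_query R k) (fun N => N%:R ^+ uphalf k : R) ->
  solvable_in_o (@ksum_access R k) (@ksum_size R k) (@ksum_correct R k)
    (fun N => N%:R ^+ uphalf k).
Proof.
move=> k0 [p [T [To pT]]].
(* [ccell nscratch] holds the translated output, a number of solutions. Its sign is turned into the
   answer bit by one test and one assignment, hence the 2 added to the time. *)
exists (Seq (translate p) (If (RLe (ccell nscratch) rzero) (NConst nscratch 0)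
  (NConst nscratch 1))), (fun n => 8 * T n + 2)%N; split.
  by apply: littleo_affine To; rewrite uphalf_gt0.
move=> x; have [t [s [e sc tT]]] := pT (faqai_of_ksum x).
have [t' [s' [e' ss' tt']]] := translate_exec e (simulates_init R k).
(* The empty tuple, at which the correctness of the output is applied. *)
pose xF : tuple_over (free_vars (ksum_query R k)) := [ffun=> 0%N].
have out := faqai_of_ksum_output_gt0 x xF; rewrite -sc in out.
exists (t' + 2)%N, (nset s' nscratch (0 < (cmem s (0%N, [::]) : R))%R); split.
- apply: ExecSeq e' _.
  have E : test_fun s' (RLe (ccell nscratch) rzero) =
      ((cmem s (0%N, [::]) : R) <= 0).
    by rewrite /test_fun (rval_rzero ss') (rval_ccell ss').
  case: ltP => c0.
    by apply: ExecIfFalse; [rewrite E -ltNge | exact: ExecNConst].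
  by apply: ExecIfTrue; [rewrite E | exact: ExecNConst].
- rewrite /ksum_correct -out /= /upd eqxx.
  by case: ltP.
- by rewrite leq_add2r (leq_trans tt') // leq_mul2l -faqai_of_ksum_size tT orbT.
Qed.

Theorem proposition3p8 (R : realType) (hksum : ksum_hardness R)
    (m : nat) (hm : (0 < m)%N) :
  exists Q : faqai_query,
    [/\ free_vars Q = finset.set0,
        m%:R <= faqw R Q
      & ~ answerable_in_o Q (fun N => N%:R `^ faqw R Q)].
Proof.
have k0 : (0 < m.*2)%N by rewrite double_gt0.
exists (ksum_query R m.*2); rewrite faqw_ksum_query; split=> //.
  by rewrite uphalf_double.
(* The width is a natural number, so the real power is the ordinary power of the hardness
   hypothesis. *)
under eq_fun do rewrite powR_mulrn //.
by move/(ksum_of_answerable k0); exact: hksum.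
Qed.
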